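(* Let $\mathcal{C}=C([0,1],\mathbb{R})$ with the supremum norm $\|\cdot\|$, and let $\mathcal{C}^n\subset\mathcal{C}$ be the subspace of $n$-times continuously differentiable functions. Let $a_0,\dots,a_n\in\mathcal{C}$ with $a_n(t)\neq 0$ for all $t\in[0,1]$, and for $1\le i,j\le n$ let $\omega_{ij}:[0,1]\to\mathbb{R}$ be of bounded variation. Define $L:\mathcal{C}^n\to\mathcal{C}$ by $[Lx](t)=a_n(t)x^{(n)}(t)+\dots+a_1(t)x'(t)+a_0(t)x(t)$ and $B:\mathcal{C}^n\to\mathbb{R}^n$ by $(Bx)_i=\sum_{j=1}^n\int_0^1 x^{(j-1)}(t)\,d\omega_{ij}(t)$ (Riemann–Stieltjes integrals). Let $\{u_1,\dots,u_n\}$ be a basis of $\ker L$ with $\|u_1\|+\dots+\|u_n\|\le 1$, set $u=(u_1,\dots,u_n)^T$, and assume the $n\times n$ matrix $\mathcal{B}=[Bu_1|\cdots|Bu_n]$ is invertible. Let $B_0=\|\mathcal{B}^{-1}\|$ (so that $\|u^T\mathcal{B}^{-1}v\|\le B_0|v|$ for all $v\in\mathbb{R}^n$), and let $A_0$ be an upper bound for the operator norm (with respect to supremum norms) of the inverse of the restriction $L|_{\ker B}:\ker B\to\mathcal{C}$. Let $\psi:\mathbb{R}\to\mathbb{R}$ be Lipschitz with constant $K_1$ and let $\eta=(\eta_1,\dots,\eta_n)^T:\mathcal{C}\to\mathbb{R}^n$ be Lipschitz with constant $K_2$. If $A_0K_1+B_0K_2<1$, then for each $h\in\mathcal{C}$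 and $v\in\mathbb{R}^n$ the boundary value problem $$a_n(t)x^{(n)}(t)+a_{n-1}(t)x^{(n-1)}(t)+\dots+a_0(t)x(t)+\psi(x(t))=h(t),\quad t\in[0,1],$$ $$\sum_{j=1}^n\int_0^1 x^{(j-1)}(t)\,d\omega_{ij}(t)+\eta_i(x)=v_i,\quad 1\le i\le n,$$ has a unique solution $x\in\mathcal{C}^n$.
   Context: $|\cdot|$ denotes a fixed norm on $\mathbb{R}^n$ and $\|\mathcal{B}^{-1}\|$ the corresponding induced matrix norm. Under the invertibility of $\mathcal{B}$, $L|_{\ker B}:\ker B\to\mathcal{C}$ is a bijective linear map, so its inverse is defined.
   Formalization: The parenthetical bound ‖u^T B^{-1} v‖ ≤ B_0|v| for all v is assumed rather than derived: it can fail for an arbitrary norm on R^n (e.g. half the usual one), and then the claim is false; it is automatic if |w|_∞ ≤ |w|, as for all ℓ^p norms. *)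

(* Defs.v *)
From HB Require Import structures.
From mathcomp Require Import all_boot all_order all_algebra.
From mathcomp Require Import all_classical all_reals all_analysis.
Set Implicit Arguments. Unset Strict Implicit. Unset Printing Implicit Defensive.
Import Order.TTheory GRing.Theory Num.Theory.
Import numFieldNormedType.Exports.
Local Open Scope classical_set_scope.
Local Open Scope ring_scope.

Definition I01 {R : realType} : set R := [set t | 0 <= t <= 1].

(* Membership in C = C([0,1],R): continuity on [0,1] (relative topology).
   Elements of C are represented by functions R -> R; only values on [0,1] matter. *)
Definition cont01 {R : realType} (f : R -> R) : Prop :=
  {within (@I01 R), continuous f}.

Definition supnorm {R : realType} (f : R -> R) : R :=
  sup [set `|f t| | t in (@I01 R)].

Definition deriv01 {R : realType} (f : R -> R) (t l : R) : Prop :=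
  forall e : R, 0 < e -> exists2 d : R, 0 < d &
    forall s : R, 0 <= s <= 1 -> s != t -> `|s - t| < d ->
      `|(f s - f t) / (s - t) - l| < e.

(* x is in C^n, with D k = x^(k) on [0,1] for k <= n:
   D 0 = x on [0,1], each D k (k <= n) is continuous on [0,1] and
   D (k+1) is the derivative of D k on [0,1] for k < n. *)
Definition Cn_chain {R : realType} (n : nat) (x : R -> R) (D : nat -> R -> R) : Prop :=
  [/\ forall t, 0 <= t <= 1 -> D 0%N t = x t,
      forall k, (k <= n)%N -> cont01 (D k) &
      forall k t, (k < n)%N -> 0 <= t <= 1 -> deriv01 (D k) t (D k.+1 t)].

Definition tagged_partition01 {R : realType} (m : nat) (p xi : nat -> R) : Prop :=
  [/\ p 0%N = 0, p m = 1,
      forall k, (k < m)%N -> p k <= p k.+1 &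
      forall k, (k < m)%N -> p k <= xi k <= p k.+1].

Definition mesh_lt {R : realType} (m : nat) (p : nat -> R) (d : R) : Prop :=
  forall k, (k < m)%N -> p k.+1 - p k < d.

Definition RS_sum {R : realType} (f w : R -> R) (m : nat) (p xi : nat -> R) : R :=
  \sum_(k < m) f (xi k) * (w (p k.+1) - w (p k)).

Definition is_RS_integral {R : realType} (f w : R -> R) (I : R) : Prop :=
  forall e : R, 0 < e -> exists2 d : R, 0 < d &
    forall m p xi, tagged_partition01 m p xi -> mesh_lt m p d ->
      `|RS_sum f w m p xi - I| < e.

(* The Riemann--Stieltjes integral \int_0^1 f dw (it exists and is unique for
   f continuous and w of bounded variation; 0 by convention otherwise). *)
Definition RS_int {R : realType} (f w : R -> R) : R :=
  xget 0 [set I | is_RS_integral f w I].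

(* [L x](t) = a_n(t) x^(n)(t) + ... + a_0(t) x(t), computed from a derivative chain D. *)
Definition Lop {R : realType} (n : nat) (a : nat -> R -> R) (D : nat -> R -> R) (t : R) : R :=
  \sum_(k < n.+1) a k t * D k t.

(* (B x)_i = sum_{j=1}^n \int_0^1 x^(j-1) d omega_ij ; indices shifted to 0..n-1. *)
Definition Bop {R : realType} (n : nat) (omega : 'I_n -> 'I_n -> R -> R)
  (D : nat -> R -> R) : 'cV[R]_n :=
  \col_i \sum_(j < n) RS_int (D j) (omega i j).

Definition is_norm {R : realType} (n : nat) (N : 'cV[R]_n -> R) : Prop :=
  [/\ forall v, N v = 0 -> v = 0,
      forall (c : R) v, N (c *: v) = `|c| * N v &
      forall v w, N (v + w) <= N v + N w].

Definition opnorm {R : realType} (n : nat) (N : 'cV[R]_n -> R) (M : 'M[R]_n) : R :=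
  sup [set N (M *m v) | v in [set v | N v <= 1]].

(* Main.v *)
Require Import Defs.
From HB Require Import structures.
From mathcomp Require Import all_boot all_order all_algebra.
From mathcomp Require Import all_classical all_reals all_analysis.
From mathcomp Require Import ring lra.
Import Order.TTheory GRing.Theory Num.Theory.
Import numFieldNormedType.Exports.
Local Open Scope classical_set_scope.
Local Open Scope ring_scope.

Set Implicit Arguments.
Unset Strict Implicit.
Unset Printing Implicit Defensive.

(** [L] is onto [C([0,1])] and the columns of [Bmat] are the boundary values of a
    basis of [ker L], so every pair [(g, b)] is [(L x, B x)] for some [x].
    Splitting [x] into an element of [ker B] and the element
    [u^T Bmat^-1 (B x)] of [ker L] gives
    [||x|| <= A0 ||L x|| + B0 |B x|].  Hence the map sending [y] to the solution
    [x] of [L x = h - psi o y], [B x = v - eta y] contracts the sup norm by the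
    factor [A0 K1 + B0 K2], and its fixed point is the unique solution. *)

(** * Continuous functions on the unit interval *)

(** That [L] is onto is itself a consequence of the fixed point theorem, which is why that theorem
    carries a weight [phi]: an exponential weight makes the Volterra operator of the linear equation
    a contraction, while the nonlinear problem uses [phi = 1]. Functions live on the whole line but
    only their values on [0,1] count, so fixed points and uniqueness are pointwise statements on
    [0,1], and [eta] has to be shown blind to all other values. [RS_int] is picked by [xget], so its
    linearity rests on existence and uniqueness of the integral. The contraction estimate multiplies
    Lipschitz bounds by [A0] and [B0], whose signs are not assumed and are found by testing their
    defining inequalities. *)

Section Continuity.
Context {R : realType}.
Implicit Types (f g : R -> R) (c t s e : R).

Lemma I01E : @I01 R = `[0, 1]%classic.
Proof. by rewrite set_itvE. Qed.

Lemma cont01P f : cont01 f <->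
  forall t, 0 <= t <= 1 -> forall e, 0 < e -> exists2 d : R, 0 < d &
    forall s, 0 <= s <= 1 -> `|s - t| < d -> `|f s - f t| < e.
Proof.
rewrite /cont01; split.
  move=> /subspace_continuousP cf t t01 e e0.
  have /cvgrPdist_lt/(_ e e0) := cf t t01.
  rewrite near_withinE => /nbhs_ballP[d /= d0 H].
  exists d => // s s01 std; rewrite distrC; apply: H => //.
  by rewrite /ball /= distrC.
move=> H; apply/subspace_continuousP => t t01; apply/cvgrPdist_lt => e e0.
rewrite near_withinE; have [d d0 {}H] := H t t01 e e0.
apply/nbhs_ballP; exists d => // s /= std s01; rewrite distrC; apply: H => //.
by move: std; rewrite /ball /= distrC.
Qed.

Lemma cont01_continuous f : continuous f -> cont01 f.
Proof. exact: continuous_subspaceT. Qed.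

Lemma cont01_cst c : cont01 (fun=> c).
Proof. by apply: cont01_continuous => t; exact: cvg_cst. Qed.

Lemma cont01D f g : cont01 f -> cont01 g -> cont01 (fun t => f t + g t).
Proof. by move=> cf cg t; apply: (@cvgD _ R^o); [exact: cf|exact: cg]. Qed.

Lemma cont01N f : cont01 f -> cont01 (fun t => - f t).
Proof. by move=> cf t; apply: (@cvgN _ R^o); exact: cf. Qed.

Lemma cont01B f g : cont01 f -> cont01 g -> cont01 (fun t => f t - g t).
Proof. by move=> cf cg; apply: cont01D => //; exact: cont01N. Qed.

Lemma cont01M f g : cont01 f -> cont01 g -> cont01 (fun t => f t * g t).
Proof. by move=> cf cg t; apply: cvgM; [exact: cf|exact: cg]. Qed.

Lemma cont01V f : (forall t, 0 <= t <= 1 -> f t != 0) -> cont01 f ->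
  cont01 (fun t => (f t)^-1).
Proof.
move=> f0 /subspace_continuousP cf; apply/subspace_continuousP => t t01.
by apply: cvgV; [exact: f0|exact: cf].
Qed.

Lemma cont01_sum (I : Type) (r : seq I) (F : I -> R -> R) :
  (forall i, cont01 (F i)) -> cont01 (fun t => \sum_(i <- r) F i t).
Proof.
move=> cF; elim: r => [|i r IH].
  by under eq_fun do rewrite big_nil; exact: cont01_cst.
by under eq_fun do rewrite big_cons; exact: cont01D.
Qed.

Lemma cont01_ext f g : (forall t, 0 <= t <= 1 -> f t = g t) ->
  cont01 f -> cont01 g.
Proof.
move=> fg /cont01P cf; apply/cont01P => t t01 e e0.
by have [d d0 H] := cf t t01 e e0; exists d => // s s01 sd; rewrite -!fg//; exact: H.
Qed.

Lemma cont01_Lipschitz (psi : R -> R) (K : R) f :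
  (forall r s, `|psi r - psi s| <= K * `|r - s|) ->
  cont01 f -> cont01 (psi \o f).
Proof.
move=> Lpsi /cont01P cf; apply/cont01P => t t01 e e0.
have K0 : 0 <= K by have := Lpsi 1 0; rewrite subr0 normr1 mulr1; exact: le_trans.
have K1 : 0 < K + 1 by rewrite ltr_wpDl.
have [|d d0 H] := cf t t01 (e / (K + 1)); first by rewrite divr_gt0.
exists d => // s s01 sd; apply: le_lt_trans (Lpsi _ _) _.
have := H s s01 sd; rewrite ltr_pdivlMr// mulrC; apply: le_lt_trans.
by rewrite ler_wpM2r// lerDl.
Qed.

Lemma cont01_bounded f : cont01 f ->
  exists2 M : R, 0 <= M & forall t, 0 <= t <= 1 -> `|f t| <= M.
Proof.
move=> cf; have [||c c01 H] := @EVT_max R (fun t => `|f t|) 0 1 => //.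
  rewrite -I01E => t; apply: (@cvg_norm _ R^o); exact: cf.
by exists `|f c| => // t t01; apply: H; rewrite in_itv.
Qed.

Lemma cont01_uniform f : cont01 f -> forall e, 0 < e -> exists2 d : R, 0 < d &
  forall s t, 0 <= s <= 1 -> 0 <= t <= 1 -> `|s - t| < d -> `|f s - f t| < e.
Proof.
move=> /cont01P cf e e0.
have := @segment_compact R 0 1; rewrite compact_near_coveringP.
(* Covering compactness is applied to the filter of radii tending to 0 from the right: a modulus
   valid near each point yields one radius for all [t]. *)
move=> /(_ R 0^'+ (fun d t => 0 <= t <= 1 -> forall s, 0 <= s <= 1 ->
  `|s - t| < d -> `|f s - f t| < e) _).
case=> [t|d /= d0 /(_ (d / 2))]; last first.
  rewrite /= sub0r normrN gtr0_norm ?divr_gt0// ltr_pdivrMr// ltr_pMr// ltr1n.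
  move=> /(_ isT) H.
  exists (d / 2) => [|s t s01 t01]; first by rewrite divr_gt0.
  by apply: H => //; rewrite ?divr_gt0//= ?in_itv.
rewrite /= in_itv /= => t01.
have e2 : 0 < e / 2 by rewrite divr_gt0.
have [d d0 H] := cf t t01 (e / 2) e2.
exists (ball t (d / 2), [set r | r < d / 2]) => /=.
  split; first by apply: nbhsx_ballx; rewrite divr_gt0.
  by apply: nbhs_right_lt; rewrite divr_gt0.
move=> [x r] /= [tx rd] x01 s s01 sx.
have h1 : `|f s - f t| < e / 2.
  apply: H => //; rewrite -(subrKA x); apply: le_lt_trans (ler_normD _ _) _.
  by move: tx; rewrite /ball /= distrC => tx; lra.
have h2 : `|f x - f t| < e / 2.
  apply: H => //; move: tx; rewrite /ball /= distrC => tx; lra.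
rewrite -(subrKA (f t)); apply: le_lt_trans (ler_normD _ _) _.
by rewrite (distrC (f t)); lra.
Qed.

Lemma le_supnorm f t : cont01 f -> 0 <= t <= 1 -> `|f t| <= supnorm f.
Proof.
move=> /cont01_bounded[M _ fM] t01; apply: ub_le_sup; last by exists t.
by exists M => _ [s s01 <-]; exact: fM.
Qed.

Lemma supnorm_le f c : (forall t, 0 <= t <= 1 -> `|f t| <= c) -> supnorm f <= c.
Proof.
move=> fc; apply: ge_sup; first by exists `|f 0|; exists 0 => //; rewrite /I01 /= lexx ler01.
by move=> _ [t t01 <-]; exact: fc.
Qed.

Lemma supnorm_ge0 f : cont01 f -> 0 <= supnorm f.
Proof. by move=> cf; rewrite (le_trans _ (@le_supnorm f 0 cf _))// lexx ler01. Qed.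

Lemma supnorm_ext f g : (forall t, 0 <= t <= 1 -> f t = g t) -> supnorm f = supnorm g.
Proof. by move=> fg; congr sup; apply: eq_imagel => t /fg ->. Qed.

Lemma supnorm_cst c : supnorm (fun=> c) = `|c|.
Proof.
apply/eqP; rewrite eq_le; apply/andP; split; first exact: supnorm_le.
by apply: (@le_supnorm (fun=> c) 0); rewrite ?lexx ?ler01//; exact: cont01_cst.
Qed.

(** The intervals [[u k - b k, u k + b k]] meet pairwise, since [u (j + k)] lies in the [j]-th and
    the [k]-th, so the supremum of the left endpoints lies in all of them. *)
Lemma seq_limit (u b : nat -> R) : (forall k m, `|u (k + m)%N - u k| <= b k) ->
  exists l, forall k, `|l - u k| <= b k.
Proof.
move=> ub.
have le_ub j k : u j - b j <= u k + b k.
  have := ub j k; have := ub k j.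
  by rewrite (addnC j) !ler_norml => /andP[_ h1] /andP[h2 _]; lra.
exists (sup [set u k - b k | k in setT]) => k; rewrite ler_norml; apply/andP; split.
  rewrite lerBrDl; apply: ub_le_sup; last by exists k.
  by exists (u 0%N + b 0%N) => _ [j _ <-]; exact: le_ub.
rewrite lerBlDl; apply: ge_sup; first by exists (u 0%N - b 0%N), 0%N.
by move=> _ [j _ <-]; exact: le_ub.
Qed.

(* Banach's fixed point theorem in [C([0,1])] for the norm [sup |f| / phi]. *)
Lemma weighted_fixed_point (phi : R -> R) (T : (R -> R) -> R -> R) (q : R) :
  cont01 phi -> (forall t, 0 <= t <= 1 -> 1 <= phi t) -> 0 <= q < 1 ->
  (forall f, cont01 f -> cont01 (T f)) ->
  (forall f g c, cont01 f -> cont01 g -> 0 <= c ->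
    (forall t, 0 <= t <= 1 -> `|f t - g t| <= c * phi t) ->
    forall t, 0 <= t <= 1 -> `|T f t - T g t| <= q * c * phi t) ->
  exists2 x, cont01 x & forall t, 0 <= t <= 1 -> T x t = x t.
Proof.
move=> cphi phi1 /andP[q0 q1] cT Tq.
pose X k := iter k T (fun=> 0).
have cX k : cont01 (X k) by elim: k => [|k IH]; [exact: cont01_cst|exact: cT].
have [C C0 HC] : exists2 C : R, 0 <= C & forall t, 0 <= t <= 1 -> `|X 1%N t - X 0%N t| <= C * phi t.
  have [C C0 H] := cont01_bounded (cont01B (cX 1%N) (cX 0%N)).
  exists C => // t t01; apply: le_trans (H t t01) _.
  by rewrite ler_peMr// phi1.
have step k t : 0 <= t <= 1 -> `|X k.+1 t - X k t| <= q ^+ k * C * phi t.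
  elim: k t => [|k IH] t t01; first by rewrite expr0 mul1r; exact: HC.
  by rewrite exprS -(mulrA q); apply: (Tq (X k.+1) (X k)) => //; rewrite mulr_ge0// exprn_ge0.
(* [E] is the sum of the geometric series [C * q ^+ k]. The equation for [E], together with the
   exact partial sum [q ^+ k - q ^+ (k + m)] in [dist], lets the induction on [m] close. *)
have [E E0 ECq] : exists2 E : R, 0 <= E & E = E * q + C.
  have q1' : 0 < 1 - q by rewrite subr_gt0.
  exists (C / (1 - q)); first by rewrite divr_ge0// ltW.
  by field; rewrite gt_eqF.
have dist k m t : 0 <= t <= 1 ->
    `|X (k + m)%N t - X k t| <= (q ^+ k - q ^+ (k + m)) * E * phi t.
  move=> t01; elim: m => [|m IH]; first by rewrite addn0 !subrr normr0 !mul0r.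
  rewrite addnS -(subrKA (X (k + m)%N t)); apply: le_trans (ler_normD _ _) _.
  apply: le_trans (lerD (step _ t t01) IH) _.
  rewrite -mulrDl ler_wpM2r ?(le_trans _ (phi1 t t01))//.
  by rewrite exprS {2}ECq; nra.
have lim t : exists l, 0 <= t <= 1 -> forall k, `|l - X k t| <= q ^+ k * E * phi t.
  have [t01|] := boolP (0 <= t <= 1); last by exists 0.
  have [|l Hl] := @seq_limit (X^~ t) (fun k => q ^+ k * E * phi t); last by exists l.
  move=> k m; apply: le_trans (dist k m t t01) _.
  rewrite ler_wpM2r ?(le_trans _ (phi1 t t01))// ler_wpM2r// lerBlDr lerDl.
  by rewrite exprn_ge0.
have [x Hx] := choice lim.
have [M M0 HM] := cont01_bounded cphi.
have qk e : 0 < e -> exists k, q ^+ k * E * M < e.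
  move=> e0; have EM : 0 < E * M + 1 by rewrite ltr_wpDl// mulr_ge0.
  have /cvgrPdist_lt/(_ (e / (E * M + 1))) : (q ^+ k @[k --> \oo] --> (0 : R)).
    by apply: cvg_expr; rewrite ger0_norm.
  case=> [|k _ /(_ k (leqnn k)) /=]; first by rewrite divr_gt0.
  rewrite sub0r normrN ger0_norm ?exprn_ge0// ltr_pdivlMr// => H.
  exists k; apply: le_lt_trans H; rewrite -mulrA ler_wpM2l ?exprn_ge0//.
  by rewrite lerDl.
have xX k t : 0 <= t <= 1 -> `|x t - X k t| <= q ^+ k * E * M.
  move=> t01; apply: le_trans (Hx t t01 k) _.
  rewrite ler_wpM2l ?mulr_ge0 ?exprn_ge0//.
  exact: le_trans (ler_norm _) (HM t t01).
have cx : cont01 x.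
  apply/cont01P => t t01 e e0.
  have e3 : 0 < e / 3 by rewrite divr_gt0.
  have [k Hk] := qk _ e3.
  have /cont01P/(_ t t01 _ e3)[d d0 H] := cX k.
  exists d => // s s01 st; have := H s s01 st.
  have := le_lt_trans (xX k s s01) Hk; have := le_lt_trans (xX k t t01) Hk.
  rewrite !ltr_norml => /andP[? ?] /andP[? ?] /andP[? ?].
  by apply/andP; split; lra.
exists x => // t t01; apply/eqP; rewrite -subr_eq0 -normr_le0.
apply/ler_addgt0Pl => e e0; rewrite addr0.
have e2 : 0 < e / 2 by rewrite divr_gt0.
have [k Hk] := qk _ e2.
(* Both [T x] and [x] are close to [X k.+1], which is [T (X k)]. *)
have h1 : `|T x t - T (X k) t| <= q ^+ k.+1 * E * phi t.
  rewrite exprS -!mulrA (mulrA q) mulrA -(mulrA q); apply: Tq => //.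
    by rewrite mulr_ge0// exprn_ge0.
  by move=> s s01; exact: Hx.
have h2 := Hx t t01 k.+1.
have h3 : q ^+ k.+1 * E * phi t <= q ^+ k * E * M.
  apply: ler_pM; rewrite ?mulr_ge0 ?exprn_ge0 ?(le_trans _ (phi1 t t01))//.
    by rewrite ler_wpM2r// exprS ler_piMl ?exprn_ge0// ltW.
  exact: le_trans (ler_norm _) (HM t t01).
have := le_trans h1 h3; have := le_trans h2 h3.
rewrite -[T (X k)]/(X k.+1) !ler_norml => /andP[? ?] /andP[? ?].
by apply/andP; split; lra.
Qed.
End Continuity.

(** * Derivatives and primitives *)

Section Derivatives.
Context {R : realType}.
Implicit Types (F G f g : R -> R) (c l m t s : R).

Lemma deriv01_is_derive F t l : is_derive t 1 F l -> deriv01 F t l.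
Proof.
move=> [dF <-] e e0; have := dF; rewrite /derivable => /cvgrPdist_lt/(_ e e0).
rewrite near_withinE => /nbhs_ballP[d /= d0 H].
exists d => // s s01 st std.
have := H (s - t); rewrite /ball /= sub0r normrN => /(_ std).
rewrite subr_eq0 => /(_ st).
by rewrite distrC [_%:A]mulr1 subrK /GRing.scale /= (mulrC _^-1).
Qed.

(** At 0 and 1 [deriv01] is one-sided, so [t] has to be interior; the radius chosen below keeps
    [h + t] in [0,1]. *)
Lemma is_derive_deriv01 F t l : 0 < t < 1 -> deriv01 F t l -> is_derive t 1 F l.
Proof.
move=> /andP[t0 t1] dF.
suff H : h^-1 *: (F (h *: 1 + t) - F t) @[h --> 0^'] --> l.
  by split; [apply/cvg_ex; exists l|exact: (cvg_lim _ H)].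
apply/cvgrPdist_lt => e e0; have [d d0 H] := dF e e0.
rewrite near_withinE; apply/nbhs_ballP; exists (Num.min d (Num.min t (1 - t))).
  by rewrite /= !lt_min d0 t0 subr_gt0.
move=> h; rewrite /ball /= sub0r normrN !lt_min => /and3P[hd ht h1] h0.
have := H (h + t); rewrite addrK => /(_ _ _ hd); rewrite distrC.
rewrite [_%:A]mulr1 /GRing.scale /= (mulrC _^-1); apply.
  by move: ht h1; rewrite !ltr_norml => /andP[? ?] /andP[? ?]; apply/andP; split; lra.
by rewrite -subr_eq0 addrK.
Qed.

Lemma deriv01_combination F G c t l m : deriv01 F t l -> deriv01 G t m ->
  deriv01 (fun s => F s + c * G s) t (l + c * m).
Proof.
move=> dF dG e e0.
have c1 : 0 < `|c| + 1 by rewrite ltr_wpDl.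
have e2 : 0 < e / 2 by rewrite divr_gt0.
have [d1 d10 H1] := dF _ e2.
have [|d2 d20 H2] := dG (e / 2 / (`|c| + 1)); first by rewrite divr_gt0.
exists (Num.min d1 d2) => [|s s01 st]; first by rewrite lt_min d10.
rewrite lt_min => /andP[/(H1 s s01 st) h1 /(H2 s s01 st)].
rewrite ltr_pdivlMr// => h2.
have -> : (F s + c * G s - (F t + c * G t)) / (s - t) - (l + c * m) =
  ((F s - F t) / (s - t) - l) + c * ((G s - G t) / (s - t) - m) by ring.
apply: le_lt_trans (ler_normD _ _) _; rewrite normrM.
suff : `|c| * `|(G s - G t) / (s - t) - m| <= `|(G s - G t) / (s - t) - m| * (`|c| + 1) by lra.
by rewrite mulrC ler_wpM2l// lerDl.
Qed.

(** Near [t] the difference quotient stays within 1 of [f t], so [|f t| + 1] bounds it. *)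
Lemma deriv01_cont F f :
  (forall t, 0 <= t <= 1 -> deriv01 F t (f t)) -> cont01 F.
Proof.
move=> dF; apply/cont01P => t t01 e e0.
have [d d0 H] := dF t t01 1 ltr01.
have f1 : 0 < `|f t| + 1 by rewrite ltr_wpDl.
exists (Num.min d (e / (`|f t| + 1))) => [|s s01]; first by rewrite lt_min d0 divr_gt0.
rewrite lt_min ltr_pdivlMr// => /andP[sd se].
have [->|st] := eqVneq s t; first by rewrite subrr normr0.
have st0 : s - t != 0 by rewrite subr_eq0.
have {H} := H s s01 st sd; set q := _ / _ => Hq.
have -> : F s - F t = (s - t) * q by rewrite /q; field.
rewrite normrM; apply: le_lt_trans se; rewrite ler_wpM2l//.
rewrite -(subrK (f t) q) (le_trans (ler_normD _ _))// addrC lerD2l ltW//.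
Qed.

Lemma deriv01_ge0_le F f : (forall t, 0 <= t <= 1 -> deriv01 F t (f t)) ->
  (forall t, 0 <= t <= 1 -> 0 <= f t) ->
  forall t, 0 <= t <= 1 -> F 0 <= F t.
Proof.
move=> dF f0 t /andP[t0 t1].
have dF' s : s \in `]0, 1[ -> is_derive s 1 F (f s).
  rewrite in_itv /= => /andP[s0 s1].
  by apply: is_derive_deriv01; [rewrite s0|apply: dF; rewrite !ltW].
apply: (@ger0_derive1_ndecr R F 0 1) => //.
- by move=> s /dF' [].
- move=> s s01; rewrite derive1E (@derive_val _ _ _ _ _ _ _ (dF' s s01)).
  by apply: f0; move: s01; rewrite in_itv /= => /andP[s0 s1]; rewrite !ltW.
- by rewrite -I01E; exact: deriv01_cont dF.
Qed.

(** The bound on [f] is the derivative of [c * expR (l * t)]. Hence that function plus or minus [F]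
    is nondecreasing, and it starts from [c >= 0]. *)
Lemma deriv01_exp_bound F f c l : (forall t, 0 <= t <= 1 -> deriv01 F t (f t)) ->
  F 0 = 0 -> 0 <= c ->
  (forall t, 0 <= t <= 1 -> `|f t| <= c * l * expR (l * t)) ->
  forall t, 0 <= t <= 1 -> `|F t| <= c * expR (l * t).
Proof.
move=> dF F0 c0 fb t t01.
have dexp s : deriv01 (fun s => expR (l * s)) s (l * expR (l * s)).
  apply: deriv01_is_derive; apply: is_derive_eq.
  by rewrite /GRing.scale /= mulrC mulr1.
have bound b : `|b| = 1 -> 0 <= c * expR (l * t) + b * F t.
  move=> b1; pose H s := b * F s + c * expR (l * s).
  have dH s : 0 <= s <= 1 -> deriv01 H s (b * f s + c * (l * expR (l * s))).
    move=> s01; have d0 : deriv01 (fun=> 0) s 0.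
      by move=> e e0; exists 1 => // r _ _ _; rewrite subrr mul0r subr0 normr0.
    have := deriv01_combination c (deriv01_combination b d0 (dF s s01)) (dexp s).
    by rewrite add0r; under eq_fun do rewrite add0r.
  rewrite addrC; apply: le_trans (deriv01_ge0_le dH _ t01) => [|s s01].
    by rewrite /H F0 !mulr0 add0r expR0 mulr1.
  have := fb s s01; rewrite mulrA -[`|f s|]mul1r -b1 -normrM ler_norml.
  by move=> /andP[? _]; lra.
have := bound 1; have := bound (-1).
rewrite normrN normr1 ler_norml => /(_ erefl) ? /(_ erefl) ?.
by apply/andP; split; lra.
Qed.

Lemma primitive01 f : cont01 f ->
  exists F, F 0 = 0 /\ forall t, 0 <= t <= 1 -> deriv01 F t (f t).
Proof.
move=> /cont01P cf.
(* Clamping extends [f] continuously to the line. Integrating from -1 then makes 0 and 1 interior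
   points, where the fundamental theorem of calculus gives two-sided derivatives. *)
pose clamp (t : R) := Num.max 0 (Num.min t 1).
have clamp01 t : 0 <= clamp t <= 1.
  by rewrite /clamp le_max lexx /= ge_max ler01 ge_min lexx orbT.
have clampE t : 0 <= t <= 1 -> clamp t = t.
  by move=> /andP[t0 t1]; rewrite /clamp min_l// max_r.
have clampL s t : `|clamp s - clamp t| <= `|s - t|.
  have maxL x y : `|Num.max 0 x - Num.max 0 y| <= `|x - y| :> R.
    have := ler_norm (x - y); have := ler_norm (y - x); rewrite (distrC y).
    move: `|x - y| => z ? ?; rewrite ler_norml /Num.max.
    by case: ltP => ?; case: ltP => ?; apply/andP; split; lra.
  have minL x : Num.min x 1 = 1 - Num.max 0 (1 - x) :> R.
    by rewrite /Num.min /Num.max; do !case: ltP => ?; lra.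
  rewrite /clamp; apply: le_trans (maxL _ _) _; rewrite !minL.
  rewrite opprD addrACA subrr add0r addrC opprK.
  by apply: le_trans (maxL (1 - t) (1 - s)) _; rewrite opprD addrACA subrr add0r opprK addrC.
have cg : continuous (f \o clamp).
  move=> t; apply/cvgrPdist_lt => e e0; have [d d0 H] := cf _ (clamp01 t) e e0.
  apply/nbhs_ballP; exists d => // s; rewrite /ball /= => std.
  rewrite distrC; apply: H => //; apply: le_lt_trans (clampL _ _) _.
  by rewrite distrC.
pose F x := (\int[lebesgue_measure]_(s in [set` Interval (BLeft (-1)) (BRight x)]) (f \o clamp) s)%R.
have dF t : 0 <= t <= 1 -> deriv01 F t (f t).
  move=> t01; have /andP[t0 t1] := t01.
  have [||||d e] := @continuous_FTC1 R (f \o clamp) (BLeft (-1)) t 2.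
  - lra.
  - apply: continuous_compact_integrable; first exact: segment_compact.
    exact: continuous_subspaceT.
  - by rewrite lte_fin; lra.
  - exact: cg.
  by apply: deriv01_is_derive; split => //; rewrite -derive1E e /= clampE.
exists (fun t => F t + (-1) * F 0); split; first by ring.
move=> t t01 e e0; have [d d0 H] := dF t t01 e e0.
by exists d => // s s01 st std; rewrite opprD addrACA subrr addr0; exact: H.
Qed.
End Derivatives.

(** * Solvability of the linear differential equation *)

Section LinearEquation.
Context {R : realType}.

(* The top derivative [z = x^(n)] of a solution with zero initial data solves a
   Volterra equation, which is a contraction for the norm weighted by
   [exp (l * t)] when [l] is large. *)
Lemma Lop_surjective (n : nat) (a : nat -> R -> R) (g : R -> R) :
  (forall k, (k <= n)%N -> cont01 (a k)) ->
  (forall t, 0 <= t <= 1 -> a n t != 0) -> cont01 g ->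
  exists x D, Cn_chain n x D /\ forall t, 0 <= t <= 1 -> Lop n a D t = g t.
Proof.
move=> ca an0 cg.
(* Choice turns the primitive vanishing at 0 into a total operator [V], with arbitrary values at
   functions not continuous on [0,1]. *)
have exV (f : R -> R) : exists F : R -> R, cont01 f ->
    F 0 = 0 /\ forall t, 0 <= t <= 1 -> deriv01 F t (f t).
  have [/primitive01[F HF]|] := pselect (cont01 f); first by exists F.
  by exists f.
have {exV}[V HV] := choice exV.
have cV f : cont01 f -> cont01 (V f) by move=> /HV[_]; exact: deriv01_cont.
have ciV j f : cont01 f -> cont01 (iter j V f).
  by move=> cf; elim: j => //= j; exact: cV.
pose b k t := a k t / a n t.
have cb k : (k <= n)%N -> cont01 (b k).
  by move=> kn; apply: cont01M; [exact: ca|apply: cont01V => //; exact: ca].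
(* For [z = x^(n)] and zero data at 0, [x^(k)] is the [(n - k)]-fold primitive of [z], and [T z = z]
   is the equation divided by [a n]. *)
pose T z t := g t / a n t - \sum_(k < n) b k t * iter (n - k) V z t.
have cT z : cont01 z -> cont01 (T z).
  move=> cz; apply: cont01B.
    by apply: cont01M => //; apply: cont01V => //; exact: ca.
  by apply: cont01_sum => k; apply: cont01M; [exact/cb/ltnW|exact: ciV].
have [M M0 HM] : exists2 M : R, 0 <= M &
    forall t, 0 <= t <= 1 -> \sum_(k < n) `|b k t| <= M.
  have [M M0 HM] : exists2 M : R, 0 <= M & forall t, 0 <= t <= 1 ->
      `|\sum_(k < n) `|b k t| | <= M.
    apply: cont01_bounded; apply: cont01_sum => k.
    apply: (@cont01_Lipschitz _ (fun x => `|x|) 1); last exact/cb/ltnW.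
    by move=> r s; rewrite mul1r ler_dist_dist.
  by exists M => // t t01; apply: le_trans (ler_norm _) (HM t t01).
(* This choice gives [M / l <= 1 / 2], the contraction factor, and [l >= 1], which keeps iterated
   primitives under the bound for the first one. *)
pose l := 2 * M + 1.
have l1 : 1 <= l by rewrite lerDr mulr_ge0.
have l0 : 0 < l by apply: lt_le_trans l1.
have V_bound z1 z2 c : cont01 z1 -> cont01 z2 -> 0 <= c ->
    (forall t, 0 <= t <= 1 -> `|z1 t - z2 t| <= c * expR (l * t)) ->
    forall t, 0 <= t <= 1 -> `|V z1 t - V z2 t| <= c / l * expR (l * t).
  move=> cz1 cz2 c0 Hz t t01.
  have [V10 d1] := HV _ cz1; have [V20 d2] := HV _ cz2.
  have -> : V z1 t - V z2 t = V z1 t + (-1) * V z2 t by ring.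
  apply: (@deriv01_exp_bound _ (fun t => V z1 t + (-1) * V z2 t)
    (fun t => z1 t + (-1) * z2 t)) => //.
  - by move=> s s01; apply: deriv01_combination; [exact: d1|exact: d2].
  - by rewrite V10 V20; ring.
  - by rewrite divr_ge0// ltW.
  by move=> s s01; rewrite mulN1r divfK ?gt_eqF//; exact: Hz.
have iV_bound z1 z2 c : cont01 z1 -> cont01 z2 -> 0 <= c ->
    (forall t, 0 <= t <= 1 -> `|z1 t - z2 t| <= c * expR (l * t)) ->
    forall j t, 0 <= t <= 1 ->
    `|iter j.+1 V z1 t - iter j.+1 V z2 t| <= c / l * expR (l * t).
  move=> cz1 cz2 c0 Hz; elim=> [|j IH] t t01; first exact: V_bound.
  apply: (@V_bound (iter j.+1 V z1) (iter j.+1 V z2)) => //; try exact: ciV.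
  move=> s s01; apply: le_trans (IH s s01) _.
  by rewrite ler_wpM2r ?expR_ge0// ler_pdivrMr// ler_peMr.
have [|||||z cz Tz] := @weighted_fixed_point R (fun t => expR (l * t)) T (2^-1).
- apply: cont01_continuous => t; apply: continuous_comp; last exact: continuous_expR.
  by apply: cvgM; [exact: cvg_cst|exact: cvg_id].
- by move=> t /andP[t0 _]; rewrite -expR0 ler_expR mulr_ge0// ltW.
- lra.
- exact: cT.
- move=> z1 z2 c cz1 cz2 c0 Hz t t01.
  have -> : T z1 t - T z2 t =
      - \sum_(k < n) b k t * (iter (n - k) V z1 t - iter (n - k) V z2 t).
    rewrite /T opprB addrACA [- _ + _]addrC addrACA subrr add0r -sumrB -sumrN.
    by apply: eq_bigr => k _; ring.
  rewrite normrN; apply: le_trans (ler_norm_sum _ _ _) _.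
  apply: (@le_trans _ _ (\sum_(k < n) `|b k t| * (c / l * expR (l * t)))).
    apply: ler_sum => k _; rewrite normrM ler_wpM2l//.
    (* As [k < n], at least one primitive is taken, and it supplies the factor [1 / l]. *)
    have -> : (n - k)%N = (n - k).-1.+1 by rewrite prednK// subn_gt0.
    exact: iV_bound.
  rewrite -mulr_suml mulrA ler_wpM2r ?expR_ge0//.
  rewrite mulrA ler_pdivrMr//; apply: (@le_trans _ _ (M * c)).
    by rewrite ler_wpM2r// HM.
  by rewrite /l; nra.
exists (iter n V z), (fun k => iter (n - k) V z); split.
  split => [t _|k _|k t kn t01]; first by rewrite subn0.
    exact: ciV.
  have -> : (n - k)%N = (n - k.+1).+1 by rewrite subnS prednK// subn_gt0.
  by have [_] := HV (iter (n - k.+1) V z) (ciV _ _ cz); apply.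
move=> t t01; have := Tz t t01; rewrite /T /Lop big_ord_recr /= subnn /= => <-.
rewrite mulrBr mulrCA divff ?an0// mulr1 mulr_sumr addrCA -sumrB big1 ?addr0//.
by move=> k _; rewrite /b; field; exact: an0.
Qed.
End LinearEquation.

(** * Riemann--Stieltjes integrals *)

Section RiemannStieltjes.
Context {R : realType}.
Implicit Types (f g w V : R -> R) (p q xi zeta : nat -> R).

(** Clamping the points of one partition into the cells of another takes the place of a common
    refinement. *)
Let clamp (a b x : R) := Num.max a (Num.min x b).

Let clamp_ge (a b x : R) : a <= clamp a b x.
Proof. by rewrite le_max lexx. Qed.

Let clamp_le (a b x : R) : a <= b -> clamp a b x <= b.
Proof. by move=> ab; rewrite ge_max ab ge_min lexx orbT. Qed.

Let clamp_homo (a b x y : R) : x <= y -> clamp a b x <= clamp a b y.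
Proof.
move=> xy; rewrite ge_max clamp_ge /= le_max; apply/orP; right.
by rewrite le_min !ge_min xy lexx orbT.
Qed.

Let clamp_idl (a b x : R) : x <= a -> a <= b -> clamp a b x = a.
Proof. by move=> xa ab; rewrite /clamp min_l ?(le_trans xa)// max_l. Qed.

Let clamp_idr (a b x : R) : b <= x -> a <= b -> clamp a b x = b.
Proof. by move=> xb ab; rewrite /clamp min_r// max_r. Qed.

(* [`[a, b]] and [`[c, d]] clamp each other's endpoints to the endpoints of
   their intersection. *)
Let clampC w (a b c d : R) : a <= b -> c <= d ->
  w (clamp a b d) - w (clamp a b c) = w (clamp c d b) - w (clamp c d a).
Proof.
move=> ab cd; have [ad|da] := ltP a d; last first.
  by rewrite !(@clamp_idl a b) ?(@clamp_idr c d) ?(le_trans cd da) ?(le_trans da ab)// !subrr.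
have [cb|bc] := ltP c b; last first.
  by rewrite !(@clamp_idr a b) ?(@clamp_idl c d) ?(le_trans ab bc) ?(le_trans bc cd)// !subrr.
have -> : clamp a b d = clamp c d b.
  by rewrite /clamp !max_r 1?minC// le_min ?ab ?cd ltW.
by congr (_ - w _); rewrite /clamp !min_l ?(ltW ad) ?(ltW cb)// maxC.
Qed.

Let clamp_disjoint w (a b c d : R) : a <= b -> c <= d -> ~~ ((a <= d) && (c <= b)) ->
  w (clamp a b d) - w (clamp a b c) = 0.
Proof.
move=> ab cd; rewrite negb_and -!ltNge => /orP[da|bc].
  by rewrite !clamp_idl ?subrr ?(ltW da) ?(ltW (le_lt_trans cd da)).
by rewrite !clamp_idr ?subrr ?(ltW bc) ?(ltW (lt_le_trans bc cd)).
Qed.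

Lemma tagged_partition01_bounds m p xi k : tagged_partition01 m p xi ->
  (k <= m)%N -> 0 <= p k <= 1.
Proof.
move=> [p0 pm ple _] km; apply/andP; split.
  elim: k km => [|k IH] km; first by rewrite p0.
  by apply: le_trans (IH (ltnW km)) (ple k km).
(* The upper bound is an induction from the far end; for [j >= m] the truncated difference [m - j]
   stays at 0. *)
rewrite -pm -(subKn km); elim: (m - k)%N => [|j IH]; first by rewrite subn0.
have [jm|mj] := ltnP j m; last first.
  by rewrite (eqP (leqW mj)) -(eqP mj).
apply: le_trans IH; have := ple (m - j.+1)%N; rewrite subnSK//.
by apply; exact: leq_subr.
Qed.

(** The increment of [w] over a cell of [p] telescopes along the points of [q] clamped into that
    cell, because [q] runs from 0 to 1. *)
Lemma RS_sum_double f w m p xi (m' : nat) q zeta :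
  tagged_partition01 m p xi -> tagged_partition01 m' q zeta ->
  RS_sum f w m p xi = \sum_(k < m) \sum_(l < m') f (xi k) *
    (w (clamp (p k) (p k.+1) (q l.+1)) - w (clamp (p k) (p k.+1) (q l))).
Proof.
move=> Pp [q0 qm _ _]; apply: eq_bigr => k _; rewrite -mulr_sumr; congr (_ * _).
have [_ _ /(_ k (ltn_ord k)) pk _] := Pp.
have /andP[p0 _] := tagged_partition01_bounds Pp (ltnW (ltn_ord k)).
have /andP[_ p1] := tagged_partition01_bounds Pp (ltn_ord k).
rewrite -(big_mkord xpredT (fun l => w (clamp (p k) (p k.+1) (q l.+1)) -
   w (clamp (p k) (p k.+1) (q l)))) telescope_sumr// q0 qm.
by rewrite clamp_idr// clamp_idl.
Qed.

(** Once both sums are split over pairs of cells, [clampC] gives each pair the same increment of [w]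
    in both. Disjoint cells contribute 0; two cells that meet, each shorter than [d / 2], have tags
    less than [d] apart. The matching increments of [V] add up to [V 1 - V 0]. *)
Lemma RS_sum_close f w V (d e : R) m p xi (m' : nat) q zeta :
  (forall x y, 0 <= x -> x <= y -> y <= 1 -> `|w y - w x| <= V y - V x) ->
  (forall s t, 0 <= s <= 1 -> 0 <= t <= 1 -> `|s - t| < d -> `|f s - f t| <= e) ->
  tagged_partition01 m p xi -> tagged_partition01 m' q zeta ->
  mesh_lt m p (d / 2) -> mesh_lt m' q (d / 2) ->
  `|RS_sum f w m p xi - RS_sum f w m' q zeta| <= e * (V 1 - V 0).
Proof.
move=> wV fe Pp Pq mp mq.
pose W (h : R -> R) (k l : nat) := h (clamp (p k) (p k.+1) (q l.+1)) - h (clamp (p k) (p k.+1) (q l)).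
have [_ _ ple pxi] := Pp; have [_ _ qle qzeta] := Pq.
rewrite (RS_sum_double f w Pp Pq) (RS_sum_double f w Pq Pp) exchange_big /=.
rewrite -sumrB.
have VE : V 1 - V 0 = \sum_(l < m') \sum_(k < m) W V k l.
  have [p0 pm _ _] := Pp.
  have -> : V 1 - V 0 = RS_sum (fun=> 1) V m p xi.
    rewrite /RS_sum; under eq_bigr do rewrite mul1r.
    rewrite -(big_mkord xpredT (fun k => V (p k.+1) - V (p k))).
    by rewrite (telescope_sumr (V \o p))//= p0 pm.
  rewrite (RS_sum_double _ _ Pp Pq) exchange_big /=.
  by apply: eq_bigr => l _; apply: eq_bigr => k _; rewrite mul1r.
rewrite VE mulr_sumr; apply: le_trans (ler_norm_sum _ _ _) _.
apply: ler_sum => l _; rewrite -sumrB mulr_sumr.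
apply: le_trans (ler_norm_sum _ _ _) _; apply: ler_sum => k _.
rewrite (clampC w (qle l (ltn_ord l)) (ple k (ltn_ord k))) -mulrBl normrM -/(W w k l).
have [pk ql] := (ple k (ltn_ord k), qle l (ltn_ord l)).
have [/andP[pq qp]|disj] := boolP ((p k <= q l.+1) && (q l <= p k.+1)); last first.
  by rewrite /W !clamp_disjoint// normr0 !mulr0.
have /andP[pk0 _] := tagged_partition01_bounds Pp (ltnW (ltn_ord k)).
have /andP[_ pk1] := tagged_partition01_bounds Pp (ltn_ord k).
have /andP[ql0 _] := tagged_partition01_bounds Pq (ltnW (ltn_ord l)).
have /andP[_ ql1] := tagged_partition01_bounds Pq (ltn_ord l).
have /andP[xk1 xk2] := pxi k (ltn_ord k); have /andP[zl1 zl2] := qzeta l (ltn_ord l).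
have mpk := mp k (ltn_ord k); have mql := mq l (ltn_ord l).
apply: ler_pM => //.
  apply: fe; [apply/andP; split; lra|apply/andP; split; lra|].
  by rewrite ltr_norml; apply/andP; split; lra.
apply: wV; [exact: le_trans pk0 (clamp_ge _ _ _)|exact: clamp_homo|].
by apply: le_trans pk1; exact: clamp_le.
Qed.

(** Without partitions of arbitrarily small mesh every number would vacuously be an integral;
    uniqueness depends on them. *)
Lemma uniform_partition01 (d : R) : 0 < d -> exists m p xi,
  tagged_partition01 m p xi /\ mesh_lt m p d.
Proof.
move=> d0; exists (Num.truncn d^-1).+1.
have N0 : 0 < (Num.truncn d^-1).+1%:R :> R by [].
have dN : d^-1 < (Num.truncn d^-1).+1%:R by exact: truncnS_gt.
move: (Num.truncn d^-1).+1 N0 dN => N N0 dN.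
pose p (k : nat) : R := k%:R / N%:R.
have pS k : p k.+1 = p k + N%:R^-1 by rewrite /p -natr1 mulrDl mul1r.
have pk k : p k <= p k.+1 by rewrite pS lerDl invr_ge0 ltW.
exists p, p; split; last first.
  by move=> k _; rewrite pS addrC addKr invf_plt// posrE.
split => [||k _|k _].
- by rewrite /p mul0r.
- by rewrite /p divff// gt_eqF.
- exact: pk.
- by rewrite lexx pk.
Qed.

Lemma is_RS_integral_unique f w (I J : R) :
  is_RS_integral f w I -> is_RS_integral f w J -> I = J.
Proof.
move=> HI HJ; apply/eqP; rewrite -subr_eq0 -normr_le0.
apply/ler_addgt0Pl => e e0; rewrite addr0.
have e2 : 0 < e / 2 by rewrite divr_gt0.
have [d1 d10 H1] := HI _ e2; have [d2 d20 H2] := HJ _ e2.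
have [|m [p [xi [Pp]]]] := @uniform_partition01 (Num.min d1 d2).
  by rewrite lt_min d10.
move=> mp; have := H1 m p xi Pp; have := H2 m p xi Pp.
have mp1 : mesh_lt m p d1 by move=> k km; have := mp k km; rewrite lt_min => /andP[].
have mp2 : mesh_lt m p d2 by move=> k km; have := mp k km; rewrite lt_min => /andP[].
move=> /(_ mp2) + /(_ mp1); rewrite ltr_norml ltr_norml ler_norml.
by move=> /andP[? ?] /andP[? ?]; apply/andP; split; lra.
Qed.

(** [V x] is the total variation on [[0, x]]; additivity makes [V y - V x] the variation on
    [[x, y]]. *)
Lemma bounded_variation_majorant w : bounded_variation 0 1 w ->
  exists V, forall x y, 0 <= x -> x <= y -> y <= 1 -> `|w y - w x| <= V y - V x.
Proof.
move=> bv; exists (fun x => fine (total_variation 0 x w)) => x y x0 xy y1.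
have fin z : 0 <= z -> z <= 1 -> total_variation 0 z w \is a fin_num.
  by move=> z0 z1; apply/(bounded_variationP w z0); exact: bounded_variationl bv.
have [y0 x1] := (le_trans x0 xy, le_trans xy y1).
rewrite -lee_fin EFinB !fineK ?fin// (total_variationD w x0 xy) addeAC.
by rewrite subee ?fin// add0e; exact: total_variation_ge.
Qed.

Lemma is_RS_integral_RS_int f w : cont01 f -> bounded_variation 0 1 w ->
  is_RS_integral f w (RS_int f w).
Proof.
move=> cf /bounded_variation_majorant[V wV].
suff [I HI] : exists I, is_RS_integral f w I by exact: (xgetI _ HI).
have cauchy e : 0 < e -> exists2 d : R, 0 < d & forall m p xi m' q zeta,
    tagged_partition01 m p xi -> tagged_partition01 m' q zeta ->
    mesh_lt m p d -> mesh_lt m' q d ->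
    `|RS_sum f w m p xi - RS_sum f w m' q zeta| <= e.
  move=> e0; have V0 : 0 <= V 1 - V 0.
    by apply: le_trans (wV 0 1 _ _ _).
  have V1 : 0 < V 1 - V 0 + 1 by rewrite ltr_wpDl.
  have e1 : 0 < e / (V 1 - V 0 + 1) by rewrite divr_gt0.
  have [d d0 H] := cont01_uniform cf e1.
  exists (d / 2) => [|m p xi m' q zeta Pp Pq mp mq]; first by rewrite divr_gt0.
  apply: le_trans (RS_sum_close wV _ Pp Pq mp mq) _.
    by move=> s t s01 t01 std; apply: ltW; exact: H.
  by rewrite mulrAC ler_pdivrMr// ler_wpM2l ?lerDl// ltW.
(* [sup A] is the lower limit of the sums as the mesh tends to 0; by [cauchy], every fine sum is
   within [e / 3] of it. *)
pose A := [set r : R | exists2 d : R, 0 < d & forall m p xi,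
  tagged_partition01 m p xi -> mesh_lt m p d -> r <= RS_sum f w m p xi].
exists (sup A) => e e0; have e3 : 0 < e / 3 by rewrite divr_gt0.
have [d d0 H] := cauchy _ e3; exists d => // m p xi Pp mp.
have A_ub : ubound A (RS_sum f w m p xi + e / 3).
  move=> r [d' d'0 Hr]; have [|k [q [zeta [Pq mq]]]] := @uniform_partition01 (Num.min d d').
    by rewrite lt_min d0.
  have mq1 : mesh_lt k q d by move=> j jk; have := mq j jk; rewrite lt_min => /andP[].
  have mq2 : mesh_lt k q d' by move=> j jk; have := mq j jk; rewrite lt_min => /andP[].
  have := H _ _ _ _ _ _ Pp Pq mp mq1; rewrite ler_norml => /andP[? _].
  by have := Hr _ _ _ Pq mq2; lra.
have A_mem : A (RS_sum f w m p xi - e / 3).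
  exists d => // k q zeta Pq mq.
  by have := H _ _ _ _ _ _ Pp Pq mp mq; rewrite ler_norml => /andP[_ ?]; lra.
have : sup A <= RS_sum f w m p xi + e / 3.
  by apply: ge_sup => //; exists (RS_sum f w m p xi - e / 3).
have : RS_sum f w m p xi - e / 3 <= sup A.
  by apply: ub_le_sup => //; exists (RS_sum f w m p xi + e / 3).
by move=> ? ?; rewrite ltr_norml; apply/andP; split; lra.
Qed.

Lemma RS_int_combination f g w (c : R) : cont01 f -> cont01 g ->
  bounded_variation 0 1 w ->
  RS_int (fun t => f t + c * g t) w = RS_int f w + c * RS_int g w.
Proof.
move=> cf cg bv; apply: (@is_RS_integral_unique (fun t => f t + c * g t) w).
  by apply: is_RS_integral_RS_int => //; apply: cont01D => //; apply: cont01M => //; exact: cont01_cst.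
have c1 : 0 < `|c| + 1 by rewrite ltr_wpDl.
move=> e e0; have e2 : 0 < e / 2 by rewrite divr_gt0.
have [d1 d10 H1] := is_RS_integral_RS_int cf bv e2.
have [d2 d20 H2] := is_RS_integral_RS_int cg bv (divr_gt0 e2 c1).
exists (Num.min d1 d2) => [|m p xi Pp mp]; first by rewrite lt_min d10.
have mp1 : mesh_lt m p d1 by move=> k km; have := mp k km; rewrite lt_min => /andP[].
have mp2 : mesh_lt m p d2 by move=> k km; have := mp k km; rewrite lt_min => /andP[].
have -> : RS_sum (fun t => f t + c * g t) w m p xi =
    RS_sum f w m p xi + c * RS_sum g w m p xi.
  by rewrite /RS_sum mulr_sumr -big_split /=; apply: eq_bigr => k _; ring.
have := H1 m p xi Pp mp1; have := H2 m p xi Pp mp2; rewrite ltr_pdivlMr// => h2 h1.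
rewrite opprD addrACA -mulrBr; apply: le_lt_trans (ler_normD _ _) _.
rewrite normrM; move: (normr_ge0 (RS_sum g w m p xi - RS_int g w)) h2.
by move: `|RS_sum g w m p xi - RS_int g w| => X X0 h2; nra.
Qed.
End RiemannStieltjes.

(** * The boundary value problem *)

Section BoundaryValueOperators.
Context {R : realType} (n : nat) (a : nat -> R -> R) (omega : 'I_n -> 'I_n -> R -> R).
Hypothesis ca : forall k, (k <= n)%N -> cont01 (a k).
Hypothesis bv_omega : forall i j, bounded_variation 0 1 (omega i j).
Implicit Types (x y : R -> R) (D E : nat -> R -> R) (c : R).

Lemma Cn_chain_cont x D : Cn_chain n x D -> cont01 x.
Proof. by move=> [D0 cD _]; apply: cont01_ext D0 (cD 0%N _). Qed.

Lemma Cn_chain_combination c x y D E : Cn_chain n x D -> Cn_chain n y E ->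
  Cn_chain n (fun t => x t + c * y t) (fun k t => D k t + c * E k t).
Proof.
move=> [Dx cD dD] [Ey cE dE]; split => [t t01|k kn|k t kn t01].
- by rewrite Dx// Ey.
- apply: cont01D; first exact: cD.
  by apply: cont01M; [exact: cont01_cst|exact: cE].
- by apply: deriv01_combination; [exact: dD|exact: dE].
Qed.

Lemma Lop_combination c D E t :
  Lop n a (fun k t => D k t + c * E k t) t = Lop n a D t + c * Lop n a E t.
Proof. by rewrite /Lop mulr_sumr -big_split; apply: eq_bigr => k _ /=; ring. Qed.

Lemma Bop_combination c x y D E : Cn_chain n x D -> Cn_chain n y E ->
  Bop omega (fun k t => D k t + c * E k t) = Bop omega D + c *: Bop omega E.
Proof.
move=> [_ cD _] [_ cE _]; apply/matrixP => i j; rewrite !mxE mulr_sumr -big_split.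
apply: eq_bigr => k _; apply: RS_int_combination => //.
  exact/cD/ltnW.
exact/cE/ltnW.
Qed.

(** Starting from [x] instead of 0 makes the case of the empty sum the hypothesis on [x] itself. *)
Lemma Cn_chain_linear_combination (I : Type) (r : seq I) (c : I -> R)
    (u : I -> R -> R) (Du : I -> nat -> R -> R) x D :
  (forall i, Cn_chain n (u i) (Du i)) -> Cn_chain n x D ->
  let x' t := x t + \sum_(i <- r) c i * u i t in
  let D' k t := D k t + \sum_(i <- r) c i * Du i k t in
  [/\ Cn_chain n x' D',
      forall t, Lop n a D' t = Lop n a D t + \sum_(i <- r) c i * Lop n a (Du i) t &
      Bop omega D' = Bop omega D + \sum_(i <- r) c i *: Bop omega (Du i)].
Proof.
move=> Hu HD x' D'; rewrite {}/x' {}/D'; elim: r => [|i r [IH1 IH2 IH3]].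
  have -> : (fun t => x t + \sum_(i <- [::]) c i * u i t) = x.
    by apply/funext => t; rewrite big_nil addr0.
  have -> : (fun k t => D k t + \sum_(i <- [::]) c i * Du i k t) = D.
    by apply/funext => k; apply/funext => t; rewrite big_nil addr0.
  by split => // [t|]; rewrite big_nil addr0.
have -> : (fun t => x t + \sum_(j <- i :: r) c j * u j t) =
    (fun t => (x t + \sum_(j <- r) c j * u j t) + c i * u i t).
  by apply/funext => t; rewrite big_cons addrCA addrC.
have -> : (fun k t => D k t + \sum_(j <- i :: r) c j * Du j k t) =
    (fun k t => (D k t + \sum_(j <- r) c j * Du j k t) + c i * Du i k t).
  by apply/funext => k; apply/funext => t; rewrite big_cons addrCA addrC.
split; first exact: Cn_chain_combination.
  by move=> t; rewrite Lop_combination IH2 big_cons addrCA addrC.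
by rewrite (Bop_combination _ IH1 (Hu i)) IH3 big_cons addrCA addrC.
Qed.

Variables (u : 'I_n -> R -> R) (Du : 'I_n -> nat -> R -> R).
Hypothesis chain_u : forall k, Cn_chain n (u k) (Du k).
Hypothesis Lu0 : forall k t, 0 <= t <= 1 -> Lop n a (Du k) t = 0.
Let Bmat : 'M[R]_n := \matrix_(i, j) (Bop omega (Du j)) i 0.
Hypothesis Bmat_unit : Bmat \in unitmx.

Let Bmat_mul (c : 'cV[R]_n) : \sum_k c k 0 *: Bop omega (Du k) = Bmat *m c.
Proof.
apply/matrixP => i j; rewrite ord1 summxE !mxE.
by apply: eq_bigr => k _; rewrite !mxE mulrC.
Qed.

(* Adding an element of [ker L] changes [B x] arbitrarily and [L x] not at all. *)
Lemma Bop_adjust x D (b : 'cV[R]_n) : Cn_chain n x D ->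
  let c := invmx Bmat *m (b - Bop omega D) in
  exists D', [/\ Cn_chain n (fun t => x t + \sum_k u k t * c k 0) D',
    forall t, 0 <= t <= 1 -> Lop n a D' t = Lop n a D t & Bop omega D' = b].
Proof.
move=> HD c.
have [h1 h2 h3] := Cn_chain_linear_combination (index_enum 'I_n) (fun k => c k 0) chain_u HD.
exists (fun k t => D k t + \sum_i c i 0 * Du i k t); split.
- have -> // : (fun t => x t + \sum_k u k t * c k 0) = (fun t => x t + \sum_k c k 0 * u k t).
  by apply/funext => t; congr (_ + _); apply: eq_bigr => k _; rewrite mulrC.
- by move=> t t01; rewrite h2 big1 ?addr0// => k _; rewrite Lu0// mulr0.
- by rewrite h3 Bmat_mul /c mulmxA mulmxV// mul1mx addrC subrK.
Qed.

Lemma Lop_Bop_surjective (g : R -> R) (b : 'cV[R]_n) :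
  (forall t, 0 <= t <= 1 -> a n t != 0) -> cont01 g ->
  exists x D, [/\ Cn_chain n x D,
    forall t, 0 <= t <= 1 -> Lop n a D t = g t & Bop omega D = b].
Proof.
move=> an0 cg; have [x [D [HD LD]]] := Lop_surjective ca an0 cg.
have [D' [h1 h2 h3]] := Bop_adjust b HD.
by eexists; exists D'; split => //; [exact: h1|move=> t t01; rewrite h2// LD].
Qed.

Variables (N : 'cV[R]_n -> R) (A0 B0 : R).
Hypothesis B0P : forall b : 'cV[R]_n,
  supnorm (fun t => \sum_k u k t * (invmx Bmat *m b) k 0) <= B0 * N b.
Hypothesis A0P : forall x D, Cn_chain n x D -> Bop omega D = 0 ->
  supnorm x <= A0 * supnorm (Lop n a D).
Hypothesis NN : forall b, N (- b) = N b.

Lemma supnorm_Lop_Bop x D : Cn_chain n x D ->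
  supnorm x <= A0 * supnorm (Lop n a D) + B0 * N (Bop omega D).
Proof.
(* The target value 0 moves [x] into [ker B] by adding [S = - u^T Bmat^-1 (B x)], with [L x]
   unchanged; then [x = (x + S) - S]. *)
move=> HD; have [D' []] := Bop_adjust 0 HD; rewrite sub0r.
pose S t := \sum_k u k t * (invmx Bmat *m - Bop omega D) k 0.
rewrite -[X in Cn_chain _ X]/(fun t => x t + S t) => h1 h2 h3.
have cS : cont01 S.
  apply: cont01_sum => k; apply: cont01M; first exact: Cn_chain_cont (chain_u k).
  exact: cont01_cst.
apply: (@le_trans _ _ (supnorm (fun t => x t + S t) + supnorm S)).
  apply: supnorm_le => t t01; rewrite -[x t](addrK (S t)).
  apply: le_trans (ler_normB _ _) _; apply: lerD; last exact: le_supnorm.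
  exact: (@le_supnorm _ (fun t => x t + S t) t (Cn_chain_cont h1) t01).
apply: lerD; last by have := B0P (- Bop omega D); rewrite NN.
by rewrite -(supnorm_ext h2); exact: A0P h1 h3.
Qed.
End BoundaryValueOperators.

(** [is_norm] lists no sign condition; the triangle inequality for [b] and [- b] gives
    [0 <= 2 * N b]. *)
Lemma is_norm_ge0 {R : realType} (n : nat) (N : 'cV[R]_n -> R) b : is_norm N -> 0 <= N b.
Proof.
move=> [_ NZ ND]; have := ND b (- b); rewrite subrr -scaleN1r NZ.
by rewrite -[in X in N X](scale0r b) NZ normr0 normrN normr1 mul0r mul1r; lra.
Qed.

Unset Implicit Arguments.

Theorem theorem1 (R : realType) (n : nat) (n_gt0 : (0 < n)%N)
  (a : nat -> R -> R) (omega : 'I_n -> 'I_n -> R -> R)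
  (u : 'I_n -> R -> R) (Du : 'I_n -> nat -> R -> R)
  (N : 'cV[R]_n -> R) (A0 K1 K2 : R)
  (psi : R -> R) (eta : (R -> R) -> 'cV[R]_n) :
  (* coefficients a_0, ..., a_n in C, a_n nowhere zero on [0,1] *)
  (forall k, (k <= n)%N -> cont01 (a k)) ->
  (forall t, 0 <= t <= 1 -> a n t != 0) ->
  (* omega_ij of bounded variation on [0,1] *)
  (forall i j, bounded_variation 0 1 (omega i j)) ->
  (* {u_1, ..., u_n} is a basis of ker L (Du k is the derivative chain of u k) *)
  (forall k, Cn_chain n (u k) (Du k)) ->
  (forall k t, 0 <= t <= 1 -> Lop n a (Du k) t = 0) ->
  (forall c : 'cV[R]_n, (forall t, 0 <= t <= 1 -> \sum_k c k 0 * u k t = 0) -> c = 0) ->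
  (forall x D, Cn_chain n x D -> (forall t, 0 <= t <= 1 -> Lop n a D t = 0) ->
     exists c : 'cV[R]_n, forall t, 0 <= t <= 1 -> x t = \sum_k c k 0 * u k t) ->
  \sum_k supnorm (u k) <= 1 ->
  (* the matrix [B u_1 | ... | B u_n] is invertible *)
  let Bmat : 'M[R]_n := \matrix_(i, j) (Bop omega (Du j)) i 0 in
  Bmat \in unitmx ->
  (* |.| a fixed norm on R^n, B0 = ||Bmat^-1|| the induced matrix norm *)
  is_norm N ->
  let B0 := opnorm N (invmx Bmat) in
  (* "so that ||u^T Bmat^-1 v|| <= B0 |v| for all v" *)
  (forall v : 'cV[R]_n,
     supnorm (fun t => \sum_k u k t * (invmx Bmat *m v) k 0) <= B0 * N v) ->
  (* A0 bounds the operator norm of (L restricted to ker B)^-1 *)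
  (forall x D, Cn_chain n x D -> Bop omega D = 0 ->
     supnorm x <= A0 * supnorm (Lop n a D)) ->
  (* psi Lipschitz with constant K1, eta : C -> R^n Lipschitz with constant K2 *)
  (forall r s, `|psi r - psi s| <= K1 * `|r - s|) ->
  (forall f g, cont01 f -> cont01 g -> N (eta f - eta g) <= K2 * supnorm (f \- g)) ->
  A0 * K1 + B0 * K2 < 1 ->
  forall (h : R -> R) (v : 'cV[R]_n), cont01 h ->
    exists x : R -> R,
      (exists D, [/\ Cn_chain n x D,
                     (forall t, 0 <= t <= 1 -> Lop n a D t + psi (x t) = h t) &
                     Bop omega D + eta x = v]) /\
      (forall y Dy, Cn_chain n y Dy ->
         (forall t, 0 <= t <= 1 -> Lop n a Dy t + psi (y t) = h t) ->
         Bop omega Dy + eta y = v ->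
         forall t, 0 <= t <= 1 -> y t = x t).
Proof.
move=> ca an0 bv chain_u Lu0 _ _ _ Bmat Bu [N0 NZ ND] B0 B0P A0P psiK etaK q1 h v ch.
have Nn : is_norm N by [].
have NN b : N (- b) = N b by rewrite -scaleN1r NZ normrN normr1 mul1r.
have K1_ge0 : 0 <= K1.
  by have := psiK 1 0; rewrite subr0 normr1 mulr1; exact: le_trans.
have K2_ge0 : 0 <= K2.
  have := etaK _ _ (@cont01_cst R 1) (@cont01_cst R 0).
  rewrite (@supnorm_ext _ _ (fun=> 1)); last by move=> t _; rewrite /= subr0.
  by rewrite supnorm_cst normr1 mulr1; apply: le_trans; exact: is_norm_ge0.
(* The sign of [A0] shows on an element of [ker B] with [L x] nonzero; the solution of [L x = 1],
   [B x = 0] is one. *)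
have A0_ge0 : 0 <= A0.
  have [x [D [HD LD BD]]] := Lop_Bop_surjective ca bv chain_u Lu0 Bu 0 an0 (@cont01_cst R 1).
  have := A0P x D HD BD; rewrite (supnorm_ext LD) supnorm_cst normr1 mulr1.
  by apply: le_trans; exact: supnorm_ge0 (Cn_chain_cont HD).
have B0_ge0 : 0 <= B0.
  (* This vector is nonzero because [n > 0], so [0 <= B0 * N b] settles the sign of [B0]. *)
  pose b : 'cV[R]_n := const_mx 1.
  have Nb : 0 < N b.
    rewrite lt_def is_norm_ge0// andbT; apply/eqP => /N0/matrixP/(_ (Ordinal n_gt0) 0).
    by rewrite !mxE => /eqP; rewrite oner_eq0.
  rewrite -(pmulr_lge0 _ Nb); apply: le_trans (B0P b); apply: supnorm_ge0.
  apply: cont01_sum => k; apply: cont01M; first exact: Cn_chain_cont (chain_u k).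
  exact: cont01_cst.
have est := supnorm_Lop_Bop bv chain_u Lu0 Bu B0P A0P NN.
pose sol y x D := [/\ Cn_chain n x D,
  forall t, 0 <= t <= 1 -> Lop n a D t + psi (y t) = h t & Bop omega D + eta y = v].
(* This serves twice: for the contraction property of [T], and, with [y1 = x1] and [y2 = x2], for
   uniqueness. The difference [x1 - x2] has image [psi y2 - psi y1] under [L] and boundary value
   [eta y2 - eta y1]. *)
have contr y1 y2 x1 x2 D1 D2 c : cont01 y1 -> cont01 y2 ->
    sol y1 x1 D1 -> sol y2 x2 D2 ->
    (forall t, 0 <= t <= 1 -> `|y1 t - y2 t| <= c) ->
    supnorm (fun t => x1 t - x2 t) <= (A0 * K1 + B0 * K2) * c.
  move=> cy1 cy2 [ch1 L1 BB1] [ch2 L2 BB2] yc.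
  have := est _ _ (Cn_chain_combination (-1) ch1 ch2).
  rewrite (Bop_combination bv _ ch1 ch2).
  under [X in supnorm X <= _]eq_fun do rewrite mulN1r; move=> /le_trans; apply.
  rewrite mulrDl -!mulrA; apply: lerD; rewrite ler_wpM2l//.
    apply: supnorm_le => t t01; rewrite Lop_combination.
    have -> : Lop n a D1 t + -1 * Lop n a D2 t = psi (y2 t) - psi (y1 t).
      by have := L1 t t01; have := L2 t t01; lra.
    apply: le_trans (psiK _ _) _; rewrite ler_wpM2l// distrC; exact: yc.
  have -> : Bop omega D1 + -1 *: Bop omega D2 = - (eta y1 - eta y2).
    rewrite scaleN1r opprB -[Bop omega D1](addrK (eta y1)) BB1.
    by rewrite -[Bop omega D2](addrK (eta y2)) BB2 opprB addrC addrA subrK.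
  rewrite NN; apply: le_trans (etaK _ _ cy1 cy2) _.
  by rewrite ler_wpM2l//; exact: supnorm_le.
have exT y : exists x, cont01 y -> exists D, sol y x D.
  have [cy|] := pselect (cont01 y); last by exists y.
  have [x [D [h1 h2 h3]]] := Lop_Bop_surjective ca bv chain_u Lu0 Bu (v - eta y) an0
    (cont01B ch (cont01_Lipschitz psiK cy)).
  exists x => _; exists D; split => // [t t01|]; first by rewrite h2//= subrK.
  by rewrite h3 subrK.
have {exT}[T HT] := choice exT.
have cT y : cont01 y -> cont01 (T y).
  by move=> /HT[D []/Cn_chain_cont].
have q01 : 0 <= A0 * K1 + B0 * K2 < 1 by rewrite q1 addr_ge0 ?mulr_ge0.
have [||z cz Tz] := @weighted_fixed_point R (fun=> 1) T _ (@cont01_cst R 1) _ q01 cT.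
- by [].
- move=> f g c cf cg c0 fg t t01; rewrite mulr1.
  have [D1 S1] := HT f cf; have [D2 S2] := HT g cg.
  apply: le_trans (contr _ _ _ _ _ _ c cf cg S1 S2 _); last first.
    by move=> s s01; have := fg s s01; rewrite mulr1.
  exact: (@le_supnorm _ (fun t => T f t - T g t) t (cont01B (cT f cf) (cT g cg)) t01).
have [D [chD LD BD]] := HT z cz.
(* The chain [D] belongs to [T z], but its boundary condition involves [eta z], and [T z] equals [z]
   only on [0,1]. The Lipschitz bound makes [eta] insensitive to values elsewhere. *)
have eta_ext f g : cont01 f -> cont01 g -> (forall t, 0 <= t <= 1 -> f t = g t) ->
    eta f = eta g.
  move=> cf cg fg; apply/eqP; rewrite -subr_eq0; apply/eqP/N0/eqP.
  rewrite eq_le is_norm_ge0// andbT; apply: le_trans (etaK _ _ cf cg) _.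
  rewrite (@supnorm_ext _ _ (fun=> 0)); last by move=> t t01; rewrite /= fg// subrr.
  by rewrite supnorm_cst normr0 mulr0.
have solx : sol (T z) (T z) D.
  split => // [t t01|]; first by rewrite Tz// LD.
  by rewrite -BD; congr (_ + _); apply: eta_ext => //; exact: cT.
exists (T z); split; first by exists D.
move=> y Dy chy Ly By t t01.
have cy := Cn_chain_cont chy; have cTz := cT z cz.
have d_ge0 := supnorm_ge0 (cont01B cy cTz).
have le_d : supnorm (fun t => y t - T z t) <=
    (A0 * K1 + B0 * K2) * supnorm (fun t => y t - T z t).
  apply: (contr _ _ _ _ _ _ _ cy cTz (And3 chy Ly By) solx) => s s01.
  exact: (@le_supnorm _ (fun t => y t - T z t) s (cont01B cy cTz) s01).
have d0 : supnorm (fun t => y t - T z t) <= 0 by nra.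
apply/eqP; rewrite -subr_eq0 -normr_le0; apply: le_trans d0.
exact: (@le_supnorm _ (fun t => y t - T z t) t (cont01B cy cTz) t01).
Qed.
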